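(* Let $R$ be a $G$-graded commutative ring, $M$ a graded $R$-module, and $N$ a graded $R$-submodule of $M$. Suppose that $S\subseteq h(R)$ is a multiplicatively closed subset with $(N:_RM)\cap S=\emptyset$. If $N\in GSpec_s({}_RM)$ for some $s\in S$, then $S^{-1}N$ is a graded prime $S^{-1}R$-submodule of $S^{-1}M$.
   Context: $G$ is a group with identity $e$; rings are commutative with nonzero unity $1$ and modules are unital. A ring $R$ is $G$-graded if $R=\bigoplus_{g\in G}R_g$ with additive subgroups $R_g$ satisfying $R_gR_h\subseteq R_{gh}$; $h(R)=\bigcup_{g\in G}R_g$ and $h^*(R)=h(R)\setminus\{0\}$. An $R$-module $M$ is $G$-graded if $M=\bigoplus_{g\in G}M_g$ with additive subgroups $M_g$ satisfying $R_gM_h\subseteq M_{gh}$; $h(M)=\bigcup_{g\in G}M_g$. A submodule $N$ of $M$ is graded if $N=\bigoplus_{g\in G}(N\cap M_g)$. Write $(N:_RM)=\{r\in R: rM\subseteq N\}$. For $s\in h^*(R)$, a graded $R$-submodule $N$ of $M$ is graded $s$-prime if $s\notin(N:_RM)$ and, for all $r\in h(R)$ and $m\in h(M)$, $rm\in N$ implies $sr\in(N:_RM)$ or $sm\in N$; $GSpec_s({}_RM)$ is the set of these. A graded prime submodule is a proper graded $R$-submodule $N$ of $M$ such that for all $r\in h(R)$, $m\in h(M)$, $rm\in N$ implies $r\in(N:_RM)$ or $m\in N$. A multiplicatively closed subset $S$ of $R$ satisfies $0\notin S$, $1\in S$, and $st\in S$ for all $s,t\in S$. For such $S\subseteq h(R)$,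 $S^{-1}R$ is a graded ring with $(S^{-1}R)_g=\{\frac{a}{s}: a\in R_h,\ s\in S\cap R_{hg^{-1}}\text{ for some } h\in G\}$, and $S^{-1}M$ is a graded $S^{-1}R$-module with $(S^{-1}M)_g=\{\frac{m}{s}: m\in M_h,\ s\in S\cap R_{hg^{-1}}\text{ for some } h\in G\}$. *)

(* Defs.v *)
From HB Require Import structures.
From mathcomp Require Import all_boot all_algebra.
From mathcomp Require Import generic_quotient ring boolp classical_sets.

Set Implicit Arguments.
Unset Strict Implicit.
Unset Printing Implicit Defensive.

Import GRing.Theory.
Local Open Scope classical_set_scope.
Local Open Scope quotient_scope.
Local Open Scope ring_scope.

Section DirectSum.
Variables (G : choiceType) (V : zmodType).

(* B is the internal direct sum of the additive subgroups A g; G may be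
   infinite, so elements are sums over finite duplicate-free lists. *)
Definition is_direct_sum (A : G -> set V) (B : set V) : Prop :=
  [/\ forall g, zmod_closed (mem (A g)),
      forall x, B x <-> exists (s : seq G) (f : G -> V),
        [/\ uniq s, forall g, A g (f g) & x = \sum_(g <- s) f g]
    & forall (s : seq G) (f : G -> V), uniq s -> (forall g, A g (f g)) ->
        \sum_(g <- s) f g = 0 -> forall g, g \in s -> f g = 0].

Definition homog (A : G -> set V) : set V := \bigcup_g A g.

End DirectSum.

Record gradedRing (G : groupType) (R : comNzRingType) := GradedRing {
  ring_comp :> G -> set R;
  ring_comp_sum : is_direct_sum ring_comp setT;
  ring_comp_mul : forall g h a b,
    ring_comp g a -> ring_comp h b -> ring_comp (g * h)%g (a * b)
}.

Record gradedModule (G : groupType) (R : comNzRingType) (gR : gradedRing G R)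
    (M : lmodType R) := GradedModule {
  mod_comp :> G -> set M;
  mod_comp_sum : is_direct_sum mod_comp setT;
  mod_comp_scale : forall g h a m,
    gR g a -> mod_comp h m -> mod_comp (g * h)%g (a *: m)
}.

Definition colon (R : comNzRingType) (M : lmodType R) (N : set M) : set R :=
  [set r | forall m, N (r *: m)].

Definition mult_closed (R : comNzRingType) (S : set R) : Prop :=
  ~ S 0 /\ mulr_closed (mem S).

Section GradedSubmodules.
Variables (G : groupType) (R : comNzRingType) (gR : gradedRing G R).
Variables (M : lmodType R) (gM : gradedModule gR M).

Definition graded_submodule (N : set M) : Prop :=
  submod_closed (mem N) /\ is_direct_sum (fun g => N `&` gM g) N.

Definition graded_prime_submodule (N : set M) : Prop :=
  [/\ graded_submodule N, N <> setT
    & forall r m, homog gR r -> homog gM m -> N (r *: m) ->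
        colon N r \/ N m].

Definition graded_s_prime (s : R) (N : set M) : Prop :=
  [/\ graded_submodule N, ~ colon N s
    & forall r m, homog gR r -> homog gM m -> N (r *: m) ->
        colon N (s * r) \/ N (s *: m)].

(* The notion is only considered for nonzero homogeneous s. *)
Definition GSpec (s : R) : set (set M) :=
  [set N | [/\ homog gR s, s != 0 & graded_s_prime s N]].

End GradedSubmodules.

Section LocalizedModule.
Variables (R : comNzRingType) (S : set R) (hS : mult_closed S).

Definition den1 : S.
Proof. by exists 1; case: hS => _ []. Defined.

Definition denM (s t : S) : S.
Proof. by exists (val s * val t); case: hS => _ [_]; apply; apply: valP. Defined.

Lemma val_den1 : val den1 = 1. Proof. by []. Qed.
Lemma val_denM s t : val (denM s t) = val s * val t. Proof. by []. Qed.

Variable M : lmodType R.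

(* (m, s) and (n, t) give the same fraction when u (t m - s n) = 0 for some
   u in S; the factor u is needed since S may contain zero divisors. *)
Definition frac_eqv (x y : M * S) : bool :=
  `[< exists u : S,
        val u *: (val y.2 *: x.1) = val u *: (val x.2 *: y.1) >].

Lemma frac_eqv_refl : reflexive frac_eqv.
Proof. by move=> x; apply/asboolP; exists den1. Qed.

Lemma frac_eqv_sym : symmetric frac_eqv.
Proof. by move=> x y; apply/asboolP/asboolP => -[u e]; exists u. Qed.

Lemma frac_eqv_trans : transitive frac_eqv.
Proof.
move=> [n t] [m s] [p v] /asboolP[/= u e] /asboolP[/= w e'].
apply/asboolP; exists (denM t (denM u w)) => /=.
rewrite !scalerA in e e' *.
transitivity ((val w * val v) *: ((val u * val t) *: m)).
  by rewrite scalerA /=; congr (_ *: _); ring.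
rewrite e scalerA.
transitivity ((val u * val s) *: ((val w * val v) *: n)).
  by rewrite scalerA /=; congr (_ *: _); ring.
by rewrite e' scalerA /=; congr (_ *: _); ring.
Qed.

Canonical frac_eqv_equiv :=
  EquivRel frac_eqv frac_eqv_refl frac_eqv_sym frac_eqv_trans.

Definition locmod := {eq_quot frac_eqv}.

HB.instance Definition _ : EqQuotient _ frac_eqv locmod := EqQuotient.on locmod.
HB.instance Definition _ := Choice.on locmod.

Definition frac (m : M) (s : S) : locmod := \pi_locmod (m, s).

Lemma frac_eq m s n t :
  frac m s = frac n t <-> exists u : S,
    val u *: (val t *: m) = val u *: (val s *: n).
Proof. by split => [/eqmodP/asboolP|e]; last apply/eqmodP/asboolP. Qed.

Lemma fracW (P : locmod -> Prop) : (forall m s, P (frac m s)) -> forall x, P x.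
Proof. by move=> h; elim/quotW => -[m s]; apply: h. Qed.

Definition num (x : locmod) : M := (repr x).1.
Definition den (x : locmod) : S := (repr x).2.

Lemma frac_num_den x : frac (num x) (den x) = x.
Proof. by rewrite /frac -surjective_pairing reprK. Qed.

Definition loc_add (x y : locmod) : locmod :=
  frac (val (den y) *: num x + val (den x) *: num y) (denM (den x) (den y)).
Definition loc_opp (x : locmod) : locmod := frac (- num x) (den x).

Lemma loc_addE m s n t :
  loc_add (frac m s) (frac n t) = frac (val t *: m + val s *: n) (denM s t).
Proof.
have := frac_num_den (frac m s); have := frac_num_den (frac n t).
rewrite /loc_add; move: (num _) (den _) (num _) (den _) => m' s' n' t'.
move=> /frac_eq[u e] /frac_eq[v e']; apply/frac_eq; exists (denM u v) => /=.
rewrite !scalerDr !scalerA in e e' *; congr (_ + _).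
  transitivity ((val u * val t * val t') *: ((val v * val s) *: m')).
    by rewrite scalerA /=; congr (_ *: _); ring.
  by rewrite e' scalerA /=; congr (_ *: _); ring.
transitivity ((val v * val s * val s') *: ((val u * val t) *: n')).
  by rewrite scalerA /=; congr (_ *: _); ring.
by rewrite e scalerA /=; congr (_ *: _); ring.
Qed.

Lemma loc_oppE m s : loc_opp (frac m s) = frac (- m) s.
Proof.
have := frac_num_den (frac m s); rewrite /loc_opp.
move: (num _) (den _) => m' s' /frac_eq[u e]; apply/frac_eq; exists u.
by rewrite !scalerN e.
Qed.

Lemma loc_addA : associative loc_add.
Proof.
elim/fracW => m s; elim/fracW => n t; elim/fracW => p v.
rewrite !loc_addE; apply/frac_eq; exists den1; rewrite !scale1r /=.
by rewrite !scalerDr !scalerA !addrA; congr (_ *: _ + _ *: _ + _ *: _); ring.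
Qed.

Lemma loc_addC : commutative loc_add.
Proof.
elim/fracW => m s; elim/fracW => n t; rewrite !loc_addE addrC.
by apply/frac_eq; exists den1; rewrite /= (mulrC (val s)).
Qed.

Lemma loc_add0 : left_id (frac 0 den1) loc_add.
Proof.
elim/fracW => m s; rewrite loc_addE; apply/frac_eq; exists den1.
by rewrite /= scaler0 add0r !scale1r mul1r.
Qed.

Lemma frac0 s t : frac 0 s = frac 0 t.
Proof. by apply/frac_eq; exists den1; rewrite !scaler0. Qed.

Lemma loc_addN : left_inverse (frac 0 den1) loc_opp loc_add.
Proof.
by elim/fracW => m s; rewrite loc_oppE loc_addE scalerN addNr; apply: frac0.
Qed.

HB.instance Definition _ :=
  GRing.isZmodule.Build locmod loc_addA loc_addC loc_add0 loc_addN.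

Lemma fracD m s n t :
  frac m s + frac n t = frac (val t *: m + val s *: n) (denM s t).
Proof. exact: loc_addE. Qed.

Lemma fracN m s : - frac m s = frac (- m) s.
Proof. exact: loc_oppE. Qed.

Lemma frac0E s : frac 0 s = 0. Proof. exact: frac0. Qed.

Lemma frac_eq0 m s : frac m s = 0 <-> exists u : S, val u *: m = 0.
Proof.
rewrite -(frac0E s) frac_eq; split => -[u e].
  by exists (denM u s); rewrite /= -scalerA e !scaler0.
by exists u; rewrite scalerA mulrC -scalerA e !scaler0.
Qed.

Lemma fracMl m s t : frac (val t *: m) (denM t s) = frac m s.
Proof.
by apply/frac_eq; exists den1; rewrite !scalerA /=; congr (_ *: _); ring.
Qed.

Lemma fracDl m n s : frac (m + n) s = frac m s + frac n s.
Proof. by rewrite fracD -scalerDr fracMl. Qed.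

Lemma frac_sum (I : Type) (r : seq I) (F : I -> M) s :
  frac (\sum_(i <- r) F i) s = \sum_(i <- r) frac (F i) s.
Proof.
by elim: r => [|i r IH]; rewrite ?big_nil ?frac0E // !big_cons fracDl IH.
Qed.

Definition loc_submodule (N : set M) : set locmod :=
  [set x | exists n (s : S), N n /\ x = frac n s].

End LocalizedModule.
Arguments loc_submodule {R S} hS {M} N.

Section LocalizedRing.
Variables (R : comNzRingType) (S : set R) (hS : mult_closed S).

(* The product of this ring is loc_scale at M = R^o, that is
   (a / s) (b / t) = (a b) / (s t), see loc_scaleE. *)
Definition locring := locmod hS R^o.
HB.instance Definition _ := GRing.Zmodule.on locring.

Definition loc_scale (M : lmodType R) (r : locring) (x : locmod hS M) :
    locmod hS M :=
  frac hS ((num r : R) *: num x) (denM hS (den r) (den x)).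

Lemma loc_scaleE (M : lmodType R) (a : R) s (m : M) t :
  loc_scale (frac hS (a : R^o) s) (frac hS m t) =
  frac hS (a *: m) (denM hS s t).
Proof.
have := frac_num_den (frac hS m t); have := frac_num_den (frac hS (a : R^o) s).
rewrite /loc_scale; move: (num _) (den _) (num _) (den _) => m' t' a' s'.
move=> /frac_eq[u e] /frac_eq[v e']; apply/frac_eq; exists (denM hS u v) => /=.
have {}e : val u * (val s * a') = val u * (val s' * a) := e.
rewrite !scalerA in e' *.
transitivity ((val u * (val s * a')) *: ((val v * val t) *: m')).
  by rewrite scalerA /=; congr (_ *: _); ring.
by rewrite e e' scalerA /=; congr (_ *: _); ring.
Qed.

Lemma loc_mulA : associative (@loc_scale R^o).
Proof.
elim/fracW => a s; elim/fracW => b t; elim/fracW => c v.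
rewrite (loc_scaleE b t (c : R^o) v) (loc_scaleE a s (b : R^o) t) !loc_scaleE.
apply/frac_eq; exists (den1 hS).
by rewrite /GRing.scale /=; ring.
Qed.

Lemma loc_mulC : commutative (@loc_scale R^o).
Proof.
elim/fracW => a s; elim/fracW => b t.
rewrite !loc_scaleE; apply/frac_eq; exists (den1 hS).
by rewrite /GRing.scale /=; ring.
Qed.

Lemma loc_mul1 : left_id (frac hS (1 : R^o) (den1 hS)) (@loc_scale R^o).
Proof.
elim/fracW => a s; rewrite !loc_scaleE; apply/frac_eq; exists (den1 hS).
by rewrite /GRing.scale /=; ring.
Qed.

Lemma loc_mulDl : left_distributive (@loc_scale R^o) +%R.
Proof.
elim/fracW => a s; elim/fracW => b t; elim/fracW => c v.
rewrite fracD (loc_scaleE a s (c : R^o) v) (loc_scaleE b t (c : R^o) v).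
rewrite loc_scaleE fracD; apply/frac_eq; exists (den1 hS).
by rewrite /GRing.scale /=; ring.
Qed.

Lemma loc_1_neq0 : frac hS (1 : R^o) (den1 hS) != 0.
Proof.
apply/eqP => /frac_eq0[u]; rewrite /GRing.scale /= mulr1 => u0.
by case: hS => + _; apply; rewrite -u0; apply: set_mem; apply: valP.
Qed.

HB.instance Definition _ := GRing.Zmodule_isComNzRing.Build locring
  loc_mulA loc_mulC loc_mul1 loc_mulDl loc_1_neq0.

End LocalizedRing.

Section LocalizedModuleScale.
Variables (R : comNzRingType) (S : set R) (hS : mult_closed S).
Variable M : lmodType R.

Lemma loc_scaleA (a b : locring hS) (x : locmod hS M) :
  loc_scale a (loc_scale b x) = loc_scale (a * b) x.
Proof.
elim/fracW: a => a s; elim/fracW: b => b t; elim/fracW: x => m v.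
rewrite (loc_scaleE hS b t m v) [_ * _](loc_scaleE hS a s (b : R^o) t) !loc_scaleE.
apply/frac_eq; exists (den1 hS).
by rewrite !scalerA /GRing.scale /=; congr (GRing.scale _ _); ring.
Qed.

Lemma loc_scale1 : left_id (1 : locring hS) (@loc_scale _ _ hS M).
Proof.
elim/fracW => m s; rewrite loc_scaleE; apply/frac_eq; exists (den1 hS).
by rewrite !scalerA /=; congr (_ *: _); ring.
Qed.

Lemma loc_scaleDr : right_distributive (@loc_scale _ _ hS M) +%R.
Proof.
elim/fracW => a s; elim/fracW => m t; elim/fracW => n v.
rewrite fracD (loc_scaleE hS a s m t) (loc_scaleE hS a s n v) loc_scaleE fracD.
apply/frac_eq; exists (den1 hS).
by rewrite !(scalerDr, scalerA) /=; congr (_ *: _ + _ *: _); ring.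
Qed.

Lemma loc_scaleDl (x : locmod hS M) :
  {morph (@loc_scale _ _ hS M)^~ x : a b / a + b}.
Proof.
elim/fracW => a s; elim/fracW => b t; elim/fracW: x => m v.
rewrite (fracD hS (a : R^o)) (loc_scaleE hS a s m v) (loc_scaleE hS b t m v).
rewrite loc_scaleE fracD; apply/frac_eq; exists (den1 hS); rewrite !(scalerDr, scalerDl, scalerA) /GRing.scale /=.
by rewrite -!scalerDl; congr (_ *: _); ring.
Qed.

HB.instance Definition _ := GRing.Zmodule_isLmodule.Build (locring hS)
  (locmod hS M) loc_scaleA loc_scale1 loc_scaleDr loc_scaleDl.

End LocalizedModuleScale.

Section LocalizedGrading.
Variables (G : groupType) (R : comNzRingType) (gR : gradedRing G R).
Variables (S : set R) (hS : mult_closed S) (hSh : S `<=` homog gR).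

Definition loc_comp (M : lmodType R) (A : G -> set M) (g : G) :
    set (locmod hS M) :=
  [set x | exists h m (s : S),
     [/\ A h m, gR (h * g^-1)%g (val s) & x = frac hS m s]].

Lemma den_homog (s : S) : exists k, gR k (val s).
Proof. by have [k _ ks] := hSh (set_mem (valP s)); exists k. Qed.

Lemma den_neq0 (s : S) : val s <> 0.
Proof. by case: hS => S0 _ s0; apply: S0; rewrite -s0; apply/set_mem/valP. Qed.

Section Module.
Variables (M : lmodType R) (A : G -> set M).
Hypothesis A_sum : is_direct_sum A setT.
Hypothesis A_scale : forall g h a m, gR g a -> A h m -> A (g * h)%g (a *: m).

Lemma comp0 g : A g 0.
Proof. by have [/(_ g)[+ _] _ _] := A_sum; rewrite !inE. Qed.

Lemma compB g x y : A g x -> A g y -> A g (x - y).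
Proof.
by have [/(_ g)[_ +] _ _] := A_sum; move=> /(_ x y); rewrite !inE; apply.
Qed.

Lemma comp_disj g h x : A g x -> A h x -> x <> 0 -> g = h.
Proof.
move=> gx hx x0; apply: contrapT => /eqP ngh; apply: x0.
have [_ _ /(_ [:: g; h] (fun k => if k == g then x else
  if k == h then - x else 0))] := A_sum.
have hg : (h == g) = false by rewrite eq_sym (negbTE ngh).
rewrite /= inE ngh big_cons big_seq1 eqxx hg eqxx => /(_ isT).
move=> /(_ _ _ g); rewrite eqxx inE eqxx => -> //; last exact: subrr.
move=> k; case: eqP => [->//|_]; case: eqP => [->|_]; last exact: comp0.
by rewrite -sub0r; apply: compB => //; apply: comp0.
Qed.

Lemma loc_compP g x : loc_comp A g x <->
  exists k m (s : S), [/\ gR k (val s), A (k * g)%g m & x = frac hS m s].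
Proof.
split=> [[h [m [s [hm ks ->]]]]|[k [m [s [ks km ->]]]]].
  by exists (h * g^-1)%g, m, s; rewrite mulgVK.
by exists (k * g)%g, m, s; rewrite mulgK.
Qed.

End Module.

Lemma den_comm (s t : S) k l : gR k (val s) -> gR l (val t) ->
  (k * l = l * k)%g.
Proof.
move=> ks lt; apply: (comp_disj (M := R^o) (ring_comp_sum gR)).
- exact: ring_comp_mul ks lt.
- by rewrite mulrC; apply: ring_comp_mul lt ks.
- exact: (@den_neq0 (denM hS s t)).
Qed.

Section Module2.
Variables (M : lmodType R) (A : G -> set M).
Hypothesis A_sum : is_direct_sum A setT.
Hypothesis A_scale : forall g h a m, gR g a -> A h m -> A (g * h)%g (a *: m).

Lemma loc_comp0 g : loc_comp A g 0.
Proof.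
have [k k1] := den_homog (den1 hS).
apply/loc_compP; exists k, 0, (den1 hS); split=> //.
exact: comp0.
Qed.

Lemma loc_compB g x y : loc_comp A g x -> loc_comp A g y ->
  loc_comp A g (x - y).
Proof.
move=> /loc_compP[k [m [s [ks km ->]]]] /loc_compP[l [n [t [lt ln ->]]]].
apply/loc_compP; exists (k * l)%g, (val t *: m - val s *: n), (denM hS s t).
split; first exact: ring_comp_mul.
  apply: compB => //; last by rewrite -mulgA; apply: A_scale.
  by rewrite (den_comm ks lt) -mulgA; apply: A_scale.
by rewrite fracN fracD scalerN.
Qed.

Lemma loc_common_den (s : seq G) (f : G -> locmod hS M) : uniq s ->
    (forall g, loc_comp A g (f g)) ->
  exists (k : G) (d : S) (m : G -> M), [/\ gR k (val d),
    forall g, A (k * g)%g (m g) & forall g, g \in s -> f g = frac hS (m g) d].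
Proof.
move=> + fA; elim: s => [_|g s IH /= /andP[gs /IH[k [d [m [kd km fm]]]]]].
  have [k k1] := den_homog (den1 hS).
  by exists k, (den1 hS), (fun=> 0); split=> // g; apply: comp0.
have /loc_compP[l [n [t [lt ln fg]]]] := fA g.
exists (l * k)%g, (denM hS t d),
  (fun h => if h == g then val d *: n else val t *: m h); split=> [|h|h].
- exact: ring_comp_mul.
- case: eqP => [->|_]; last by rewrite -mulgA; apply: A_scale.
  by rewrite (den_comm lt kd) -mulgA; apply: A_scale.
- rewrite inE; case: eqP => [->|_ /fm ->]; last by rewrite fracMl.
  rewrite fg => _; apply/frac_eq; exists (den1 hS).
  by rewrite !scalerA /=; congr (_ *: _); ring.
Qed.

Lemma loc_comp_sum : is_direct_sum (loc_comp A) setT.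
Proof.
have [_ A_span A_free] := A_sum; split=> [g|x|s f us fA].
- split=> [|x y]; rewrite !inE; first exact: loc_comp0.
  exact: loc_compB.
- split=> // _; elim/fracW: x => m d; have [k kd] := den_homog d.
  have [s [f [us fA ->]]] := (A_span m).1 I.
  exists [seq (k^-1 * h)%g | h <- s], (fun g => frac hS (f (k * g)%g) d).
  split; first by rewrite map_inj_uniq //; apply: mulgI.
    by move=> g; apply/loc_compP; exists k, (f (k * g)%g), d.
  by rewrite big_map frac_sum; apply: eq_bigr => h _; rewrite mulVKg.
- have [k [d [m [kd km fm]]]] := loc_common_den us fA.
  rewrite (eq_big_seq (fun g => frac hS (m g) d)) // -frac_sum.
  move=> /frac_eq0[u]; have [l lu] := den_homog u; rewrite scaler_sumr => e g gs.
  rewrite fm //; apply/frac_eq0; exists u.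
  have := A_free [seq (l * k * h)%g | h <- s]
    (fun h => val u *: m ((l * k)^-1 * h)%g).
  rewrite big_map map_inj_uniq; last exact: mulgI.
  move=> /(_ us); under eq_bigr do rewrite mulKg.
  move=> /(_ _ e (l * k * g)%g); rewrite mulKg; apply.
    move=> h; rewrite -[X in A X](mulVKg (l * k)%g h) -mulgA.
    exact: A_scale.
  exact: map_f.
Qed.

Lemma loc_comp_scale g h r x :
  loc_comp (M := R^o) gR g r -> loc_comp A h x ->
  loc_comp A (g * h)%g (loc_scale r x).
Proof.
move=> /loc_compP[k [a [s [ks ka ->]]]] /loc_compP[l [m [t [lt lm ->]]]].
rewrite loc_scaleE.
have [ta0|ta0] := pselect (val t * a = 0).
  suff -> : frac hS (a *: m) (denM hS s t) = 0 by apply: loc_comp0.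
  by apply/frac_eq0; exists t; rewrite scalerA ta0 scale0r.
apply/loc_compP; exists (k * l)%g, (a *: m), (denM hS s t); split=> //.
  exact: ring_comp_mul.
have kl := den_comm ks lt.
have e : (k * g * l = l * (k * g))%g.
  apply: (comp_disj (M := R^o) (ring_comp_sum gR)) ta0.
    by rewrite mulrC; apply: ring_comp_mul.
  exact: ring_comp_mul.
have -> : (k * l * (g * h) = k * g * (l * h))%g.
  by rewrite [RHS]mulgA e kl !mulgA.
exact: A_scale.
Qed.

End Module2.

Definition loc_gradedRing : gradedRing G (locring hS) :=
  @GradedRing G (locring hS) (loc_comp (M := R^o) gR)
    (loc_comp_sum (M := R^o) (ring_comp_sum gR) (@ring_comp_mul _ _ gR))
    (loc_comp_scale (M := R^o) (ring_comp_sum gR) (@ring_comp_mul _ _ gR)).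

Definition loc_gradedModule (M : lmodType R) (gM : gradedModule gR M) :
    gradedModule loc_gradedRing (locmod hS M) :=
  @GradedModule G (locring hS) loc_gradedRing (locmod hS M) (loc_comp gM)
    (loc_comp_sum (mod_comp_sum gM) (@mod_comp_scale _ _ _ _ gM))
    (loc_comp_scale (mod_comp_sum gM) (@mod_comp_scale _ _ _ _ gM)).

End LocalizedGrading.

(* Main.v *)
(** A fraction [m / v] lies in the localization of [N] exactly when [u m] is in
    [N] for some [u] in [S].  So if [(r / t) (m / v)] lies there, then [u r m] is
    in [N] with [u r] homogeneous, and [s]-primeness gives either [s u r M]
    inside [N] or [s m] in [N]; now [s] and [u] are invertible.  Properness is
    the case [r = 1]: [s u] in the colon is excluded by disjointness from [S],
    so if every fraction were in the localization, [s] would carry every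
    homogeneous element, hence all of [M], into [N]. *)
Require Import Defs.
From mathcomp Require Import all_boot all_algebra.
From mathcomp Require Import boolp classical_sets.
Local Open Scope classical_set_scope.
Local Open Scope ring_scope.

Set Implicit Arguments.
Unset Strict Implicit.
Unset Printing Implicit Defensive.

(* [Defs] is imported again so that [frac] is not that of
   [mathcomp.algebra.fraction]. *)
Import GRing.Theory Defs.

Section Submodules.
Variables (R : comNzRingType) (M : lmodType R) (N : set M).
Hypothesis sN : submod_closed (mem N).

Lemma submod0 : N 0.
Proof. by case: sN => + _; rewrite inE. Qed.

Lemma submodD m n : N m -> N n -> N (m + n).
Proof.
case: sN => _ /(_ 1 m n); rewrite !inE scale1r => h Nm Nn; exact: h.
Qed.

Lemma submodZ a m : N m -> N (a *: m).
Proof.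
case: sN => _ /(_ a m 0); rewrite !inE addr0 => h Nm; apply: h => //.
exact: submod0.
Qed.

Lemma submodB m n : N m -> N n -> N (m - n).
Proof. by move=> Nm Nn; rewrite -scaleN1r; apply/submodD/submodZ. Qed.

Lemma submod_sum (I : Type) (r : seq I) (F : I -> M) :
  (forall i, N (F i)) -> N (\sum_(i <- r) F i).
Proof.
by move=> NF; elim/big_ind: _ => //; [apply: submod0 | apply: submodD].
Qed.

End Submodules.

Lemma mult_closedM (R : comNzRingType) (S : set R) (hS : mult_closed S) s t :
  S s -> S t -> S (s * t).
Proof. by case: hS => _ [_ /(_ s t)]; rewrite !inE => h Ss St; exact: h. Qed.

Lemma val_denP (R : comNzRingType) (S : set R) (s : S) : S (val s).
Proof. exact: set_mem (valP s). Qed.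

Lemma homogM (G : groupType) (R : comNzRingType) (gR : gradedRing G R) a b :
  homog gR a -> homog gR b -> homog gR (a * b).
Proof. by case=> g _ ga [h _ hb]; exists (g * h)%g => //; apply: ring_comp_mul. Qed.

Section LocalizedSubmodule.
Variables (R : comNzRingType) (S : set R) (hS : mult_closed S).
Variables (M : lmodType R) (N : set M).
Hypothesis sN : submod_closed (mem N).

(** Clearing denominators in [m / s = n / t] gives [u t m = u s n], which lies in [N]; conversely
    [m / s = (u m) / (u s)]. *)
Lemma loc_submoduleP m s :
  loc_submodule hS N (frac hS m s) <-> exists2 u, S u & N (u *: m).
Proof.
split=> [[n [t [Nn /frac_eq[u e]]]]|[u Su Nu]].
  exists (val u * val t); first by apply: (mult_closedM hS); apply: val_denP.
  by rewrite -scalerA e; do 2!apply: submodZ => //.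
exists (u *: m), (denM hS (SigSub (mem_set Su)) s); split=> //.
by rewrite -(fracMl hS m s (SigSub (mem_set Su))).
Qed.

Lemma loc_submodule_closed :
  submod_closed (mem (loc_submodule hS N : set (locmod hS M))).
Proof.
split; first by rewrite inE; exists 0, (den1 hS); split;
  [exact: submod0 | rewrite frac0E].
move=> + x y; rewrite !inE; elim/fracW => a s [m [t [Nm ->]]] [n [v [Nn ->]]].
rewrite [_ *: _](loc_scaleE hS a s m t) fracD inE.
exists (val v *: (a *: m) + val (denM hS s t) *: n), (denM hS (denM hS s t) v).
by split=> //; apply: submodD => //; do ?apply: submodZ => //.
Qed.

End LocalizedSubmodule.

(** Reduces membership in the colon to homogeneous elements, the only ones to which [s]-primeness
    applies. *)
Lemma homog_span (G : choiceType) (R : comNzRingType) (M : lmodType R)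
    (A : G -> set M) (N : set M) (a : R) :
    is_direct_sum A setT -> submod_closed (mem N) ->
  (forall m, homog A m -> N (a *: m)) -> forall m, N (a *: m).
Proof.
move=> [_ A_span _] sN aN m; have [s [f [_ fA ->]]] := (A_span m).1 I.
by rewrite scaler_sumr; apply: submod_sum => // g; apply: aN; exists g.
Qed.

Section GradedLocalization.
Variables (G : groupType) (R : comNzRingType) (gR : gradedRing G R).
Variables (M : lmodType R) (gM : gradedModule gR M) (N : set M).
Variables (S : set R) (hS : mult_closed S) (hSh : S `<=` homog gR).

(** Independence of the components is inherited from the grading of the localized module; spanning
    comes from decomposing a numerator inside [N]. *)
Lemma loc_graded_submodule : graded_submodule gM N ->
  graded_submodule (loc_gradedModule hS hSh gM) (loc_submodule hS N).
Proof.
move=> [sN [_ N_span _]].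
have sL := loc_submodule_closed hS sN.
have [L_zmod _ L_free] := mod_comp_sum (loc_gradedModule hS hSh gM).
split=> //; split=> [g|x|t f ut fL].
- have [z_g b_g] := L_zmod g; split=> [|x y].
    by rewrite inE; split; [apply: submod0 | move: z_g; rewrite inE].
  rewrite !inE => -[Nx gx] [Ny gy]; split; first exact: submodB.
  by move: (b_g x y); rewrite !inE; apply.
- split=> [[n [d [Nn ->]]]|[t [f [_ fL ->]]]]; last first.
    by apply: submod_sum => // g; case: (fL g).
  have [k kd] := den_homog hSh d.
  have [t [f [ut fN ->]]] := (N_span n).1 Nn.
  (* A component of degree [h] divided by [d], of degree [k], has degree [k^-1 * h]; hence the
     shifted indices. *)
  exists [seq (k^-1 * h)%g | h <- t], (fun g => frac hS (f (k * g)%g) d); split.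
  + by rewrite map_inj_uniq //; apply: mulgI.
  + move=> g; have [Nf gf] := fN (k * g)%g; split; first by exists (f (k * g)%g), d.
    by apply/loc_compP; exists k, (f (k * g)%g), d.
  + by rewrite big_map frac_sum; apply: eq_bigr => h _; rewrite mulVKg.
- by apply: L_free => // g; case: (fL g).
Qed.

Lemma loc_graded_prime s : S s -> colon N `&` S = set0 ->
  graded_s_prime gM s N ->
  graded_prime_submodule (loc_gradedModule hS hSh gM) (loc_submodule hS N).
Proof.
move=> Ss NS0 [gN nNs s_prime]; have [sN _] := gN.
split; first exact: loc_graded_submodule.
- move=> NT; apply: nNs; apply: (@homog_span _ _ _ _ _ _ (mod_comp_sum gM) sN).
  move=> m hm.
  have /loc_submoduleP[//|u Su Num] : loc_submodule hS N (frac hS m (den1 hS)).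
    by rewrite NT.
  (* Being in [S], [u] is homogeneous and can serve as the ring element in [s]-primeness. *)
  have [su|//] := s_prime u m (hSh Su) hm Num.
  have : (colon N `&` S) (s * u) by split=> //; apply: mult_closedM.
  by rewrite NS0.
move=> _ _ [g _ [h [a [t [ha _ ->]]]]] [g' _ [h' [m [v [hm _ ->]]]]].
rewrite [_ *: _](loc_scaleE hS a t m v) => /loc_submoduleP[//|u Su].
rewrite scalerA => Nuam.
have [|||sua|sm] := s_prime (u * a) m => //.
- by apply: homogM; [apply: hSh | exists h].
- by exists h'.
- left=> + ; elim/fracW => n w; rewrite [_ *: _](loc_scaleE hS a t n w).
  (* The multiplier [s * u] works for every [n], since [(s u) (a n) = (s (u a)) n]. *)
  apply/(loc_submoduleP hS sN); exists (s * u); first exact: mult_closedM.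
  by rewrite scalerA -mulrA; apply: sua.
- by right; apply/(loc_submoduleP hS sN); exists s.
Qed.

End GradedLocalization.

Theorem proposition3p4 (G : groupType) (R : comNzRingType)
    (gR : gradedRing G R) (M : lmodType R) (gM : gradedModule gR M)
    (N : set M) (hN : graded_submodule gM N)
    (S : set R) (hS : mult_closed S) (hSh : S `<=` homog gR)
    (hNS : colon N `&` S = set0) :
  (exists2 s, S s & GSpec gM s N) ->
  graded_prime_submodule (loc_gradedModule hS hSh gM) (loc_submodule hS N).
Proof. by move=> [s Ss [_ _ sp]]; apply: loc_graded_prime Ss hNS sp. Qed.
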